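(* Let $p>3$ be a prime and $t\in\mathbb Z_p$ with $t\not\equiv0\pmod p$. Then $$\sum_{k=0}^{p-1}\binom{-\frac18}k\binom{-\frac38}k(1-t)^k\equiv t^{\langle-\frac18\rangle_p}\sum_{k=0}^{p-1}\binom{-\frac18}k\binom{-\frac58}k\Big(1-\frac1t\Big)^k\equiv\begin{cases}P_{[\frac p4]}(\sqrt t)\pmod p&\text{if }p\equiv1,3\pmod8,\\ \big(\frac tp\big)\sqrt t\,P_{[\frac p4]}(\sqrt t)\pmod p&\text{if }p\equiv5,7\pmod8.\end{cases}$$
   Context: $\mathbb Z_p$ is the set of rationals with denominator coprime to $p$; congruences mod $p$ are in $\mathbb Z_p$. For $a\in\mathbb Z_p$, $\langle a\rangle_p\in\{0,\dots,p-1\}$ with $a\equiv\langle a\rangle_p\pmod p$. $[x]$ is the floor. For rational $a$, $\binom ak=a(a-1)\cdots(a-k+1)/k!$. $\big(\frac tp\big)$ is the Legendre symbol. $P_n$ is the Legendre polynomial ($P_0=1,P_1=x,(n+1)P_{n+1}=(2n+1)xP_n-nP_{n-1}$). Here $[p/4]$ is even for $p\equiv1,3\pmod8$ and odd for $p\equiv5,7\pmod 8$, so the right-hand sides are polynomials in $t$, evaluated at $t$. *)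

(* Defs.v *)
From mathcomp Require Import all_boot all_order all_algebra all_field.

Set Implicit Arguments.
Unset Strict Implicit.
Unset Printing Implicit Defensive.

Import Order.TTheory GRing.Theory Num.Theory.
Local Open Scope ring_scope.

(* The ring Z_p of rationals whose denominator is coprime to p. *)
Definition Zloc (p : nat) : {pred rat} := [pred a | coprimez (denq a) p%:Z].

(* Congruence mod p is a relation on Z_p, so both sides must lie in Z_p. *)
Definition eqmodZp (p : nat) (a b : rat) : bool :=
  [&& a \in Zloc p, b \in Zloc p & (a - b) / p%:R \in Zloc p].

(* <a>_p, the least residue of a in Z_p. The junk value p is returned if no
   residue exists, which never happens for p > 0 and a in Z_p. *)
Definition residue (p : nat) (a : rat) : nat :=
  find (fun r : nat => eqmodZp p a r%:R) (iota 0 p).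

Definition binomq (a : rat) (k : nat) : rat :=
  (\prod_(i < k) (a - i%:R)) / (k`!)%:R.

(* The Legendre symbol (a / p) of a in Z_p, for p an odd prime. *)
Definition legendre_symbol (p : nat) (a : rat) : int :=
  if eqmodZp p a 0 then 0
  else if [exists x : 'I_p, eqmodZp p ((x : nat)%:R ^+ 2) a] then 1 else -1.

Fixpoint legendreP (F : numFieldType) (n : nat) : {poly F} :=
  match n with
  | 0%N => 1
  | m.+1 =>
    match m with
    | 0%N => 'X
    | l.+1 => (m.+1)%:R^-1 *:
        ((2 * m + 1)%:R *: ('X * legendreP F m) - m%:R *: legendreP F l)
    end
  end.

(* Main.v *)
(* Since [-1/8 = a] mod [p] for the natural number [a = <-1/8>_p], every sum is
   congruent to a terminating Gauss series [2F1(-a, -y; 1; z)], and the first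
   congruence reduces to Pfaff's transformation, an identity over the rationals.
   For the second one, the quadratic transformations
     [P_(2m)(x) = 2F1(-m, m + 1/2; 1; 1 - x^2)] and
     [P_(2m+1)(x) = x 2F1(-m, m + 3/2; 1; 1 - x^2)]
   are proved from the recurrence of the Legendre polynomials. When [p = 1, 3]
   mod 8 they identify the first sum directly. When [p = 5, 7] mod 8 a second
   Pfaff transformation is needed; it leaves the power [t^((p+1)/2)], which is
   [t (t/p)] by Euler's criterion. *)
Require Import Defs.
From HB Require Import structures.
From mathcomp Require Import all_boot all_order all_algebra all_fingroup.
From mathcomp Require Import all_solvable all_field.
From mathcomp Require Import ring zify.
Import Order.TTheory GRing.Theory Num.Theory.
Local Open Scope ring_scope.

(** * The ring [Zloc p] and congruence modulo [p] *)

Lemma ZlocP (p : nat) a : reflect (exists n d : int, coprimez d p /\ a = n%:~R / d%:~R)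
  (a \in Zloc p).
Proof.
apply: (iffP idP) => [ap|[n [d [dp ->]]]].
  by exists (numq a), (denq a); split; [exact: ap | rewrite divq_num_den].
rewrite inE; case: divqP dp => [|k x _] //=; first by rewrite /coprimez gcd1z.
by rewrite coprimezMl => /andP[].
Qed.

Lemma Zloc_subring_closed p : subring_closed (Zloc p).
Proof.
split=> [|x y|x y].
- by rewrite inE /coprimez gcd1z.
- case/ZlocP=> [n [d [dp ->]]] /ZlocP[m [e [ep ->]]]; apply/ZlocP.
  (* A zero denominator is coprime to [p] when [p = 1]; the fraction is then 0, because the inverse
     of 0 is 0. *)
  have [d0|d0] := eqVneq d 0.
    exists (- m), e; split=> //; rewrite d0 invr0 mulr0 sub0r rmorphN mulNr; exact: erefl.
  have [e0|e0] := eqVneq e 0.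
    by exists n, d; rewrite e0 invr0 mulr0 subr0.
  exists (n * e - m * d), (d * e); split; first by rewrite coprimezMl dp.
  by rewrite rmorphB !rmorphM /=; field; rewrite !intr_eq0 d0 e0.
- case/ZlocP=> [n [d [dp ->]]] /ZlocP[m [e [ep ->]]]; apply/ZlocP.
  exists (n * m), (d * e); split; first by rewrite coprimezMl dp.
  by rewrite !rmorphM /= invfM mulrACA.
Qed.

HB.instance Definition _ p :=
  GRing.isSubringClosed.Build rat (Zloc p) (Zloc_subring_closed p).

Lemma eqmodZp_refl p a : a \in Zloc p -> eqmodZp p a a.
Proof. by move=> ap; rewrite /eqmodZp ap subrr mul0r rpred0. Qed.

Lemma eqmodZp_sym p a b : eqmodZp p a b -> eqmodZp p b a.
Proof. by case/and3P=> ap bp abp; rewrite /eqmodZp ap bp -opprB mulNr rpredN. Qed.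

Lemma eqmodZp_trans p b a c : eqmodZp p a b -> eqmodZp p b c -> eqmodZp p a c.
Proof.
case/and3P=> ap bp abp /and3P[_ cp bcp]; rewrite /eqmodZp ap cp.
by rewrite -(subrKA b) mulrDl rpredD.
Qed.

Lemma eqmodZpD p a b c d : eqmodZp p a b -> eqmodZp p c d -> eqmodZp p (a + c) (b + d).
Proof.
case/and3P=> ap bp abp /and3P[cp dp cdp]; rewrite /eqmodZp !rpredD //=.
by rewrite opprD addrACA mulrDl rpredD.
Qed.

Lemma eqmodZpM p a b c d : eqmodZp p a b -> eqmodZp p c d -> eqmodZp p (a * c) (b * d).
Proof.
case/and3P=> ap bp abp /and3P[cp dp cdp]; apply/and3P; split; [exact: rpredM | exact: rpredM | ].
have -> : (a * c - b * d) / p%:R = (a - b) / p%:R * c + b * ((c - d) / p%:R) by ring.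
by apply: rpredD; apply: rpredM.
Qed.

Lemma eqmodZpX p a b n : eqmodZp p a b -> eqmodZp p (a ^+ n) (b ^+ n).
Proof.
move=> ab; elim: n => [|n IHn]; first by rewrite !expr0 eqmodZp_refl ?rpred1.
by rewrite !exprS eqmodZpM.
Qed.

Lemma eqmodZp_sum p n (f g : 'I_n -> rat) :
  (forall i, eqmodZp p (f i) (g i)) -> eqmodZp p (\sum_i f i) (\sum_i g i).
Proof.
move=> fg; elim/big_rec2: _ => [|i x y _]; first by rewrite eqmodZp_refl ?rpred0.
exact: eqmodZpD.
Qed.

Lemma eqmodZp_prod p n (f g : 'I_n -> rat) :
  (forall i, eqmodZp p (f i) (g i)) -> eqmodZp p (\prod_i f i) (\prod_i g i).
Proof.
move=> fg; elim/big_rec2: _ => [|i x y _]; first by rewrite eqmodZp_refl ?rpred1.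
exact: eqmodZpM.
Qed.

Lemma Zloc_invn p n : coprime n p -> n%:R^-1 \in Zloc p.
Proof. by move=> np; apply/ZlocP; exists 1, n; rewrite div1r. Qed.

(** If [p] divided the numerator of [t], then [t / p] would still lie in [Zloc p], making [t] zero
    mod [p]. Hence the numerator can serve as a denominator. *)
Lemma Zloc_inv p t : prime p -> t \in Zloc p -> ~~ eqmodZp p t 0 -> t^-1 \in Zloc p.
Proof.
move=> pP tp; rewrite /eqmodZp tp rpred0 subr0 /=.
have [n [d [dp td]]] := ZlocP _ _ tp; rewrite td => np; apply/ZlocP.
exists d, n; split; last by rewrite invf_div.
rewrite coprimez_sym coprimezE /= prime_coprime //; apply: contra np.
rewrite -[(_ %| _)%N]/(p%:Z %| n)%Z => /dvdzP[k ->]; apply/ZlocP; exists k, d; split=> //.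
rewrite rmorphM /= -!mulrA; congr (_ * _); rewrite mulrCA divff ?mulr1 //.
by rewrite intr_eq0 -lt0n prime_gt0.
Qed.

(** * Comparison with ['F_p] and least residues *)

Lemma eqmodZp_int p (m n : int) : prime p ->
  eqmodZp p m%:~R n%:~R = (m%:~R == n%:~R :> 'F_p).
Proof.
move=> pP; rewrite -subr_eq0 -rmorphB.
have -> : eqmodZp p m%:~R n%:~R = eqmodZp p (m - n)%:~R 0.
  by rewrite /eqmodZp !rpred_int rpred0 subr0 rmorphB.
move: (m - n) => {m}n; rewrite -(@dvdz_pcharf _ p) ?pchar_Fp // /eqmodZp subr0 rpred_int rpred0 /=.
have p0 : p%:R != 0 :> rat by rewrite pnatr_eq0 -lt0n prime_gt0.
apply/idP/idP => [/ZlocP[m [d [dp E]]]|/dvdzP[k ->]]; last first.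
  by rewrite rmorphM /= mulfK ?rpred_int.
have d0 : d%:~R != 0 :> rat.
  apply: contraTneq dp => /eqP; rewrite intr_eq0 => /eqP ->.
  by rewrite coprimezE /coprime gcd0n neq_ltn prime_gt1 ?orbT.
have En : n * d = m * p.
  apply/eqP; rewrite -(eqr_int rat) !rmorphM /=; apply/eqP.
  by rewrite -[LHS](mulfVK p0) [_ * _ / _]mulrAC E mulfVK.
by rewrite -(@Gauss_dvdzl _ _ d) 1?coprimez_sym // En dvdz_mull.
Qed.

Lemma eqmodZp_nat_exists p a : prime p -> a \in Zloc p ->
  exists2 r : nat, (r < p)%N & eqmodZp p a r%:R.
Proof.
move=> pP ap; have [n [d [dp def_a]]] := ZlocP _ _ ap.
have [[u v] /= uv] := coprimezP _ _ dp.
have p0 : p%:R != 0 :> rat by rewrite pnatr_eq0 -lt0n prime_gt0.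
have d0 : d%:~R != 0 :> rat.
  apply: contraTneq dp => /eqP; rewrite intr_eq0 => /eqP ->.
  by rewrite coprimezE /coprime gcd0n neq_ltn prime_gt1 ?orbT.
(* By the Bezout relation [u * d + v * p = 1], [u] inverts the denominator [d] mod [p]. *)
exists `|(n * u %% p)%Z|%N.
  rewrite -ltz_nat gez0_abs ?modz_ge0 ?ltz_pmod // ?ltz_nat ?eqz_nat ?prime_gt0 //.
  by rewrite -lt0n prime_gt0.
rewrite /eqmodZp ap rpred_nat /= -[_%:R]/((Posz _)%:~R) gez0_abs; last first.
  by rewrite modz_ge0 // eqz_nat -lt0n prime_gt0.
have -> : a = n%:~R / d%:~R * (u * d + v * p)%:~R by rewrite uv mulr1.
have -> : (n * u %% p)%Z = n * u - (n * u %/ p)%Z * p by rewrite {2}(divz_eq (n * u) p); ring.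
rewrite !(rmorphB, rmorphD, rmorphM) /=.
have -> : (n%:~R / d%:~R * (u%:~R * d%:~R + v%:~R * p%:R) -
  (n%:~R * u%:~R - (n * u %/ p)%Z%:~R * p%:R)) / p%:R = a * v%:~R + (n * u %/ p)%Z%:~R :> rat.
  by rewrite def_a; field; rewrite d0.
by rewrite rpredD ?rpredM ?rpred_int.
Qed.

Lemma residueP p a : prime p -> a \in Zloc p ->
  (residue p a < p)%N /\ eqmodZp p a (residue p a)%:R.
Proof.
move=> pP /(eqmodZp_nat_exists _ _ pP)[r rp ar]; rewrite /residue; set P := fun r => _.
(* [find] returns an index, and in [iota 0 p] the index of an entry is the entry itself. *)
have hasP : has P (iota 0 p) by apply/hasP; exists r; rewrite ?mem_iota.
have lt_p : (find P (iota 0 p) < p)%N by rewrite -{2}(size_iota 0 p) -has_find.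
by split=> //; have := nth_find 0 hasP; rewrite nth_iota.
Qed.

Lemma residue_unique p a r : prime p -> (r < p)%N -> eqmodZp p a r%:R -> residue p a = r.
Proof.
move=> pP rp ar; have [ap _ _] := and3P ar; have [sp as_] := residueP _ _ pP ap.
have := eqmodZp_trans _ _ _ _ (eqmodZp_sym _ _ _ as_) ar.
rewrite (eqmodZp_int _ (Posz _) (Posz _)) // => /eqP/(congr1 val).
by rewrite /= !val_Fp_nat // !modn_small.
Qed.

(** * Euler's criterion in ['F_p] *)

Lemma Fp_euler p (x : 'F_p) : prime p -> odd p -> x != 0 ->
  x ^+ p./2 = if [exists y, y ^+ 2 == x] then 1 else -1.
Proof.
move=> pP podd x0.
have unit_exp (y : 'F_p) : y != 0 -> y ^+ p.-1 = 1.
  move=> y0; apply: (mulfI y0); rewrite -exprS prednK ?prime_gt0 // mulr1.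
  by rewrite -{2}(expf_card y) card_Fp.
have p1E : p.-1 = (p./2 * 2)%N by lia.
case: ifP => [/existsP[y /eqP yx]|/negbT/existsPn nsq].
  rewrite -yx -exprM mulnC -p1E unit_exp //; apply: contra x0 => /eqP y0.
  by rewrite -yx y0 expr0n.
have : x ^+ p./2 == 1 \/ x ^+ p./2 == -1.
  by apply/orP; rewrite -sqrf_eq1 -exprM -p1E unit_exp.
(* It remains to refute [x ^+ p./2 = 1] for a nonsquare [x]. With [x = z ^+ i] for a primitive root
   [z], [p - 1] divides [i * (p - 1) / 2], so [i] is even and [x] is a square. *)
case=> /eqP // xh.
pose s := [seq y <- enum 'F_p | y != 0].
have size_s : (p.-1 <= size s)%N.
  rewrite size_filter -(leq_add2r 1) addn1 prednK ?prime_gt0 //.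
  rewrite -{1}(card_Fp pP) cardE -(count_predC (fun y => y != 0)) leq_add2l.
  rewrite (eq_count (a2 := pred1 0)) => [|y /=]; last by rewrite negbK.
  by rewrite count_uniq_mem ?enum_uniq // leq_b1.
have /hasP[z _ zP] : has p.-1.-primitive_root s.
  apply: has_prim_root => //; first by have := prime_gt1 pP; lia.
    by apply/allP => y; rewrite mem_filter => /andP[y0 _]; apply/unity_rootP; exact: unit_exp.
  by rewrite filter_uniq ?enum_uniq.
have [[i ip] /= xz] := prim_rootP zP (unit_exp x x0).
have : (p.-1 %| i * p./2)%N by rewrite (prim_order_dvd zP) exprM -xz xh.
rewrite p1E [(i * _)%N]mulnC dvdn_pmul2l ?half_gt0 ?prime_gt1 // => /dvdnP[j ij].
by have := nsq (z ^+ j); rewrite -exprM -ij xz eqxx.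
Qed.

(** * Generalized binomial coefficients *)

Lemma binomq0 x : binomq x 0 = 1.
Proof. by rewrite /binomq big_ord0 divr1. Qed.

Lemma binomqS x k : binomq x k.+1 = binomq x k * ((x - k%:R) / k.+1%:R).
Proof.
by rewrite /binomq big_ord_recr /= factS natrM invfM [_.+1%:R^-1 * _]mulrC mulrACA.
Qed.

Lemma binomqS_l x k : binomq (x + 1) k.+1 = (x + 1) / k.+1%:R * binomq x k.
Proof.
elim: k => [|k IHk]; first by rewrite binomqS !binomq0 subr0 mul1r mulr1.
rewrite binomqS IHk binomqS -!natr1; field.
by rewrite !natr1 !pnatr_eq0.
Qed.

Lemma binomq_pascal x k : binomq (x + 1) k.+1 = binomq x k.+1 + binomq x k.
Proof. by rewrite binomqS_l binomqS -!natr1; field; rewrite natr1 pnatr_eq0. Qed.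

Lemma binomq_nat n k : binomq n%:R k = 'C(n, k)%:R.
Proof.
elim: n k => [|n IHn] [|k]; rewrite ?binomq0 ?bin0 //; last first.
  by rewrite -natr1 binomq_pascal !IHn binS natrD.
by rewrite binomqS; elim: k => [|k IHk]; rewrite ?subrr ?mul0r ?mulr0 // binomqS IHk mul0r.
Qed.

(** Upper negation: when the product on the left is read backwards, its factors are the
    [-(y - i)]. *)
Lemma binomq_reflect m y : binomq (- 1 - y + m%:R) m = (-1) ^+ m * binomq y m.
Proof.
rewrite /binomq mulrA; congr (_ / _); rewrite (reindex_inj rev_ord_inj) /=.
have -> : (-1) ^+ m = \prod_(i < m) -1 :> rat by rewrite prodr_const card_ord.
rewrite -big_split; apply: eq_bigr => i _.
by rewrite natrB // -natr1 /=; ring.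
Qed.

(** The first [N] terms of [2F1(-x, -y; 1; z)], as [binomq x k] is [(-1)^k (-x)_k / k!]. *)
Definition binsum N (x y z : rat) : rat :=
  \sum_(k < N) binomq x k * binomq y k * z ^+ k.

(** * Pfaff's transformation for terminating sums *)

Lemma sum_binS (R : pzRingType) a (g : nat -> R) :
  \sum_(k < a.+2) 'C(a.+1, k)%:R * g k =
  \sum_(k < a.+1) 'C(a, k)%:R * g k + \sum_(k < a.+1) 'C(a, k)%:R * g k.+1.
Proof.
rewrite big_ord_recl; under eq_bigr do rewrite /= binS natrD mulrDl.
rewrite big_split /= addrA; congr (_ + _).
rewrite big_ord_recr /= (bin_small (ltnSn a)) mul0r addr0.
by rewrite [RHS]big_ord_recl !bin0.
Qed.

(** The shift [j] is what lets the induction on [a] close: Pascal's rule for ['C(a.+1, k)] expresses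
    the left side through the shifts [j] and [j.+1]. On the right a second use of Pascal's rule, for
    [binomq], gives the same combination, with coefficients [t] and [t - 1]. *)
Lemma pfaff_shift a x j (t : rat) : t != 0 ->
  t ^+ a * \sum_(k < a.+1) 'C(a, k)%:R * (binomq x (k + j) * (1 - 1 / t) ^+ k) =
  \sum_(k < a.+1) 'C(a, k)%:R * (binomq (x + k%:R) (k + j) * (t - 1) ^+ k).
Proof.
move=> t0; elim: a j => [|a IHa] j; first by rewrite !big_ord1 addr0 expr0 mul1r.
rewrite (sum_binS _ _ (fun k => binomq x (k + j) * (1 - 1 / t) ^+ k)).
rewrite (sum_binS _ _ (fun k => binomq (x + k%:R) (k + j) * (t - 1) ^+ k)).
have tE : t * (1 - 1 / t) = t - 1 by field.
set v := 1 - 1 / t in tE IHa *; set u := t - 1.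
have -> : \sum_(k < a.+1) 'C(a, k)%:R * (binomq x (k.+1 + j) * v ^+ k.+1) =
   v * \sum_(k < a.+1) 'C(a, k)%:R * (binomq x (k + j.+1) * v ^+ k).
  by rewrite big_distrr; apply: eq_bigr => k _ /=; rewrite addSnnS exprS; ring.
set Uj := \sum_(k < _) _; set Uj1 := \sum_(k < _) _.
have -> : t ^+ a.+1 * (Uj + v * Uj1) = t * (t ^+ a * Uj) + t * v * (t ^+ a * Uj1).
  by rewrite exprS; ring.
rewrite !IHa tE.
have -> : \sum_(k < a.+1) 'C(a, k)%:R * (binomq (x + k.+1%:R) (k.+1 + j) * u ^+ k.+1) =
  u * \sum_(k < a.+1) 'C(a, k)%:R * (binomq (x + k%:R) (k + j) * u ^+ k) +
  u * \sum_(k < a.+1) 'C(a, k)%:R * (binomq (x + k%:R) (k + j.+1) * u ^+ k).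
  rewrite -mulrDr -big_split big_distrr /=; apply: eq_bigr => k _ /=.
  by rewrite -natr1 addrA addSn binomq_pascal addnS exprS; ring.
by rewrite addrA; congr (_ + _); rewrite /u; ring.
Qed.

Lemma binsum_nat N a y z : (a < N)%N ->
  binsum N a%:R y z = \sum_(k < a.+1) 'C(a, k)%:R * (binomq y k * z ^+ k).
Proof.
move=> aN; rewrite (big_ord_widen N (fun k => 'C(a, k)%:R * (binomq y k * z ^+ k))) //.
rewrite big_mkcond; apply: eq_bigr => k _; rewrite binomq_nat -mulrA.
by case: ltnP => // ak; rewrite bin_small // mulr0n !mul0r.
Qed.

(** The case [j = 0], [x = - 1 - y] of the shifted identity; upper negation supplies the sign that
    turns [(t - 1) ^+ k] into [(1 - t) ^+ k]. *)
Lemma binsum_pfaff N a y (t : rat) : t != 0 -> (a < N)%N ->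
  binsum N a%:R y (1 - t) = t ^+ a * binsum N a%:R (- 1 - y) (1 - 1 / t).
Proof.
move=> t0 aN; rewrite !binsum_nat //; have := pfaff_shift a (- 1 - y) 0 _ t0.
under eq_bigr do rewrite addn0; move=> ->; apply: eq_bigr => k _; congr (_ * _).
by rewrite addn0 binomq_reflect -(opprB t) (exprNn (t - 1)); ring.
Qed.

(** * Legendre polynomials as Gauss sums in [1 - x ^+ 2] *)

(** This is the recurrence for [P_(2m+2)] with [x ^+ 2 = 1 - w], once the even and odd Legendre
    polynomials are replaced by their Gauss sums. Coefficients of [w ^+ k.+1] are compared after
    reducing all of them to [binomq m%:R k * binomq (- m%:R - 3 / 2) k]. *)
Lemma binsum_rec_even N m w : (m.+1 < N)%N ->
  (2 * m + 2)%:R * binsum N m.+1%:R (- m.+1%:R - 1 / 2) w =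
  (4 * m + 3)%:R * (1 - w) * binsum N m%:R (- m%:R - 3 / 2) w
  - (2 * m + 1)%:R * binsum N m%:R (- m%:R - 1 / 2) w.
Proof.
case: N => // N; rewrite ltnS => mN.
rewrite -(mulrA _ (1 - w)) mulrBl mul1r; set B := binsum _ _ (_ - 3 / 2) w.
(* Multiplication by [w] raises the degree by one; the top term drops out since ['C(m, N) = 0] for
   [m < N]. *)
have -> : w * B = \sum_(k < N) binomq m%:R k * binomq (- m%:R - 3 / 2) k * w ^+ k.+1.
  rewrite /B /binsum big_ord_recr /= binomq_nat bin_small // mulr0n !mul0r addr0 big_distrr.
  by apply: eq_bigr => k _ /=; rewrite exprS; ring.
rewrite /B /binsum !big_ord_recl /= !binomq0 !expr0 /bump /=.
set S1 := \sum_(k < N) _; set S2 := \sum_(k < N) _.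
set S3 := \sum_(k < N) _; set S4 := \sum_(k < N) _.
have key : (2 * m + 2)%:R * S1 = (4 * m + 3)%:R * (S2 - S3) - (2 * m + 1)%:R * S4.
  rewrite /S1 /S2 /S3 /S4 -sumrB !big_distrr -sumrB; apply: eq_bigr => k _ /=.
  rewrite !add1n -[m.+1%:R]natr1 binomqS_l !(binomqS m%:R).
  have -> : - (m%:R + 1) - 1 / 2 = - m%:R - 3 / 2 :> rat by field.
  have -> : - m%:R - 1 / 2 = - m%:R - 3 / 2 + 1 :> rat by field.
  rewrite binomqS_l !binomqS !(natrD, natrM) -!natr1; field.
  by rewrite natr1 pnatr_eq0.
by rewrite mulrDr key !(natrD, natrM); ring.
Qed.

(** The recurrence for [P_(2m+3)] with the common factor [x] cancelled; here the common base is
    [binomq (- m%:R - 5 / 2) k]. *)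
Lemma binsum_rec_odd N m w :
  (2 * m + 3)%:R * binsum N m.+1%:R (- m.+1%:R - 3 / 2) w =
  (4 * m + 5)%:R * binsum N m.+1%:R (- m.+1%:R - 1 / 2) w
  - (2 * m + 2)%:R * binsum N m%:R (- m%:R - 3 / 2) w.
Proof.
rewrite /binsum !big_distrr -sumrB; apply: eq_bigr => -[[|k] _] _ /=.
  by rewrite !binomq0 !(natrD, natrM); ring.
rewrite -[m.+1%:R]natr1 !binomqS_l !(binomqS m%:R).
have -> : - (m%:R + 1) - 1 / 2 = - m%:R - 5 / 2 + 1 :> rat by field.
have -> : - (m%:R + 1) - 3 / 2 = - m%:R - 5 / 2 :> rat by field.
have -> : - m%:R - 3 / 2 = - m%:R - 5 / 2 + 1 :> rat by field.
rewrite !binomqS_l !binomqS !(natrD, natrM) -!natr1; field.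
by rewrite natr1 pnatr_eq0.
Qed.

Lemma legendreP_rec (F : numFieldType) n (x : F) :
  n.+2%:R * (legendreP F n.+2).[x] =
  (2 * n.+1 + 1)%:R * (x * (legendreP F n.+1).[x]) - n.+1%:R * (legendreP F n).[x].
Proof.
rewrite /= -/(legendreP F n.+1) hornerZ hornerD hornerN !hornerZ hornerM hornerX.
by rewrite mulVKf // pnatr_eq0.
Qed.

(** Only [x ^+ 2] has to be rational: [w] and both sums live in [rat] while [x] may be an irrational
    square root. *)
Lemma legendreP_binsum (F : numFieldType) m N (x : F) w :
  (m < N)%N -> ratr w = 1 - x ^+ 2 ->
  (legendreP F m.*2).[x] = ratr (binsum N m%:R (- m%:R - 1 / 2) w) /\
  (legendreP F m.*2.+1).[x] = x * ratr (binsum N m%:R (- m%:R - 3 / 2) w).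
Proof.
move=> mN wx; elim: m mN => [|m IHm] mN.
  have E y : binsum N 0 y w = 1 by rewrite (binsum_nat N 0) // big_ord1 binomq0 !mul1r.
  by rewrite !E !rmorph1 /= !hornerE.
have [IHe IHo] := IHm (ltnW mN).
have Re := congr1 (ratr : rat -> F) (binsum_rec_even N m w mN).
have Ro := congr1 (ratr : rat -> F) (binsum_rec_odd N m w).
rewrite !(rmorphB, rmorphM, rmorph_nat, rmorph1) /= in Re Ro.
have even : (legendreP F m.+1.*2).[x] = ratr (binsum N m.+1%:R (- m.+1%:R - 1 / 2) w).
  apply: (@mulfI _ (2 * m + 2)%:R); first by rewrite pnatr_eq0; lia.
  rewrite Re doubleS; have := legendreP_rec F m.*2 x; rewrite IHe IHo.
  have -> : m.*2.+2 = (2 * m + 2)%N by lia.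
  by move=> ->; rewrite wx -muln2 !(natrD, natrM) -!natr1 ?natrM; ring.
split=> //; apply: (@mulfI _ (2 * m + 3)%:R); first by rewrite pnatr_eq0; lia.
rewrite mulrCA Ro doubleS; have := legendreP_rec F m.*2.+1 x.
rewrite -doubleS even IHo => E.
have -> : (2 * m + 3)%N = m.*2.+3 by lia.
by rewrite {}E -muln2 !(natrD, natrM) -!natr1 ?natrM; ring.
Qed.

(** * Congruences for the Legendre symbol, binomial coefficients and Gauss sums *)

Lemma eqmodZp_legendre_symbol p t : prime p -> odd p -> t \in Zloc p ->
  ~~ eqmodZp p t 0 -> eqmodZp p (t ^+ p./2) (legendre_symbol p t)%:~R.
Proof.
move=> pP podd tp t0; have [r rp tr] := eqmodZp_nat_exists _ _ pP tp.
(* Replacing [t] by its residue [r] moves every congruence, and so the search for a square root,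
   into ['F_p]. *)
have eq_r (n : int) : eqmodZp p n%:~R t = (n%:~R == r%:R :> 'F_p).
  rewrite -(eqmodZp_int _ n r) //; apply/idP/idP => nt.
    exact: eqmodZp_trans nt tr.
  exact: eqmodZp_trans nt (eqmodZp_sym _ _ _ tr).
have r0 : r%:R != 0 :> 'F_p.
  by rewrite eq_sym -(eq_r 0); apply: contra t0 => /eqmodZp_sym.
apply: (eqmodZp_trans _ (r%:R ^+ p./2)); first exact: eqmodZpX.
have -> : r%:R ^+ p./2 = (r%:Z ^+ p./2)%:~R :> rat by rewrite rmorphXn.
rewrite eqmodZp_int // rmorphXn /= Fp_euler // /legendre_symbol (negPf t0).
suff -> : [exists x : 'I_p, eqmodZp p ((x : nat)%:R ^+ 2) t] =
          [exists y : 'F_p, y ^+ 2 == r%:R].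
  by case: ifP; rewrite ?rmorphN rmorph1.
apply/existsP/existsP => -[x xr].
  exists (x : nat)%:R; move: xr.
  by rewrite -natrX (eq_r (x ^ 2)%N%:Z) -[_%:~R]/((x ^ 2)%N%:R) natrX.
have xp : (x < p)%N by rewrite -[X in (_ < X)%N](Fp_cast pP).
exists (Ordinal xp); rewrite /= -natrX (eq_r (x ^ 2)%N%:Z).
by rewrite -[_%:~R]/((x ^ 2)%N%:R) natrX natr_Zp.
Qed.

Lemma Zloc_invfact p k : prime p -> (k < p)%N -> (k`!)%:R^-1 \in Zloc p.
Proof.
move=> pP; elim: k => [|k IHk] kp; first by rewrite invr1 rpred1.
rewrite factS natrM invfM rpredM ?IHk ?(ltnW kp) //.
by rewrite Zloc_invn // coprime_sym prime_coprime // gtnNdvd.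
Qed.

Lemma eqmodZp_binomq p k x y : prime p -> (k < p)%N -> eqmodZp p x y ->
  eqmodZp p (binomq x k) (binomq y k).
Proof.
move=> pP kp xy; apply: eqmodZpM; last by rewrite eqmodZp_refl ?Zloc_invfact.
by apply: eqmodZp_prod => i; apply: eqmodZpD => //; rewrite eqmodZp_refl ?rpredN ?rpred_nat.
Qed.

Lemma eqmodZp_binsum p x x' y y' z : prime p -> eqmodZp p x x' -> eqmodZp p y y' ->
  z \in Zloc p -> eqmodZp p (binsum p x y z) (binsum p x' y' z).
Proof.
move=> pP xx' yy' zp; apply: eqmodZp_sum => k.
by apply: eqmodZpM; [apply: eqmodZpM; apply: eqmodZp_binomq | rewrite eqmodZp_refl ?rpredX].
Qed.

Lemma binsumC N x y z : binsum N x y z = binsum N y x z.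
Proof. by apply: eq_bigr => k _; rewrite (mulrC (binomq x k)). Qed.

(** * Residues of [-q / 8] and the classes of [p] mod 8 *)

Lemma eqmodZp_eighth p q r j : odd p -> (8 * r + q = j * p)%N ->
  eqmodZp p (- q%:R / 8) r%:R.
Proof.
move=> podd E; have V8 : 8%:R^-1 \in Zloc p.
  by apply: Zloc_invn; rewrite (@coprime_pexpl 3 2) // coprime2n.
rewrite /eqmodZp rpred_nat /= rpredM ?rpredN ?rpred_nat //=.
have p0 : p%:R != 0 :> rat by rewrite pnatr_eq0; case: (p) podd.
have -> : (- q%:R / 8%:R - r%:R) / p%:R = - (j%:R / 8%:R) :> rat.
  have -> : q%:R = j%:R * p%:R - 8%:R * r%:R :> rat by rewrite -!natrM -E natrD addrC addKr.
  by field.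
by rewrite rpredN rpredM ?rpred_nat.
Qed.

(** Meant for [c = 1/2] and [c = 3/2]: [-1/8] and [-3/8] add up to [-1/2], [-5/8] and [-7/8] to
    [-3/2]. So if one of a pair is congruent to [m], the other is congruent to [- m - c]. *)
Lemma eqmodZp_opp_sub p a b c : c \in Zloc p -> eqmodZp p a b ->
  eqmodZp p (- a - c) (- b - c).
Proof.
move=> cp ab; apply: eqmodZpD; last by rewrite eqmodZp_refl ?rpredN.
by rewrite -mulN1r -[- b]mulN1r eqmodZpM // eqmodZp_refl ?rpredN ?rpred1.
Qed.

(** Through [eqmodZp_eighth] with [j = 1], the last disjunction makes [m] congruent to [-1/8] or to
    [-3/8]. *)
Lemma mod8_13 p : (p %% 8)%N \in [:: 1; 3]%N ->
  exists m, [/\ (p %/ 4 = m.*2)%N, (m < p)%N & (8 * m + 1 = p \/ 8 * m + 3 = p)%N].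
Proof. by rewrite !inE => p8; exists (p %/ 8)%N; split; lia. Qed.

(* In each case the last equations say, through [eqmodZp_eighth], that
   [m + p./2.+1] or [3 * m + 2 + p./2.+1] is the residue of [-1/8], and
   [3 * m + 2] that of [-5/8]. *)
Lemma mod8_57 p : (p %% 8)%N \in [:: 5; 7]%N ->
  exists m, [/\ (p %/ 4 = m.*2.+1)%N, (m < p)%N &
    [/\ 8 * m + 5 = p, m + p./2.+1 < p & 8 * (m + p./2.+1) + 1 = 5 * p]%N \/
    [/\ 8 * m + 7 = p, 3 * m + 2 + p./2.+1 < p
      & 8 * (3 * m + 2 + p./2.+1) + 1 = 7 * p /\ 8 * (3 * m + 2) + 5 = 3 * p]%N].
Proof.
rewrite !inE => p8; exists (p %/ 8)%N; split; [lia | lia |].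
by case/orP: p8 => p8; [left | right]; repeat split; lia.
Qed.

(** The Legendre values lie in [algC], so the congruence is stated for the rational [v] whose image
    they are. *)
Theorem theorem5p1 (p : nat) (t : rat)
    (p_prime : prime p) (p_gt3 : (3 < p)%N)
    (t_Zp : t \in Zloc p) (t_neq0 : ~~ eqmodZp p t 0) :
  let S1 : rat :=
    \sum_(k < p) binomq (- 1 / 8) k * binomq (- 3 / 8) k * (1 - t) ^+ k in
  let S2 : rat :=
    t ^+ residue p (- 1 / 8) *
      \sum_(k < p) binomq (- 1 / 8) k * binomq (- 5 / 8) k * (1 - 1 / t) ^+ k in
  let s : algC := sqrtC (ratr t) in
  [/\ eqmodZp p S1 S2,
      (p %% 8)%N \in [:: 1; 3]%N ->
        exists2 v : rat,
          ratr v = (legendreP algC (p %/ 4)).[s] & eqmodZp p S2 v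
    & (p %% 8)%N \in [:: 5; 7]%N ->
        exists2 v : rat,
          ratr v = (legendre_symbol p t)%:~R * s * (legendreP algC (p %/ 4)).[s]
          & eqmodZp p S2 v].
Proof.
move=> S1 S2 s.
have podd : odd p by case: (even_prime p_prime) p_gt3 => // ->.
have t0 : t != 0 by apply: contraNneq t_neq0 => ->; rewrite eqmodZp_refl ?rpred0.
have tV : t^-1 \in Zloc p by apply: Zloc_inv.
have z1 : 1 - t \in Zloc p by rewrite rpredB ?rpred1.
have z2 : 1 - 1 / t \in Zloc p by rewrite div1r rpredB ?rpred1.
have V2 q : q%:R / 2%:R \in Zloc p.
  by rewrite rpredM ?rpred_nat // Zloc_invn // coprime2n.
have V8 q : eqmodZp p (- q%:R / 8%:R) (- q%:R / 8%:R).
  apply: eqmodZp_refl; rewrite rpredM ?rpredN ?rpred_nat // Zloc_invn //.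
  by rewrite (@coprime_pexpl 3 2) // coprime2n.
have ws : ratr (1 - t) = 1 - s ^+ 2 by rewrite rmorphB rmorph1 sqrtCK.
have [V8Zp _ _] := and3P (V8 1%N).
have [ap aE] := residueP _ _ p_prime V8Zp.
have S12 : eqmodZp p S1 S2.
  (* Pfaff's identity needs a natural upper parameter, so [-1/8] is replaced by its residue and
     restored afterwards. *)
  apply: (eqmodZp_trans _ (binsum p (residue p (- 1 / 8))%:R (- 3 / 8) (1 - t))).
    exact: eqmodZp_binsum p_prime aE (V8 3%N) z1.
  rewrite (binsum_pfaff _ _ _ _ t0 ap); apply: eqmodZpM.
    by apply: eqmodZp_refl; apply: rpredX.
  have -> : - 1 - - 3 / 8 = - 5 / 8 :> rat by field.
  exact: eqmodZp_binsum p_prime (eqmodZp_sym _ _ _ aE) (V8 5%N) z2.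
have legendreZ x y : eqmodZp p x y ->
    eqmodZp p ((legendre_symbol p t)%:~R * (t * x)) ((legendre_symbol p t)%:~R * (t * y)).
  move=> xy; apply: eqmodZpM; first by apply: eqmodZp_refl; apply: rpred_int.
  by apply: eqmodZpM => //; apply: eqmodZp_refl.
split; first exact: S12.
  move=> /mod8_13[m [mE mp hm]]; exists (binsum p m%:R (- m%:R - 1 / 2) (1 - t)).
    by rewrite mE; case: (legendreP_binsum _ m p s _ mp ws).
  apply: eqmodZp_trans (eqmodZp_sym _ _ _ S12) _.
  case: hm => hm.
    have mr : eqmodZp p (- 1 / 8) m%:R.
      by apply: (@eqmodZp_eighth _ 1 _ 1) => //; rewrite mul1n.
    have := eqmodZp_opp_sub _ _ _ _ (V2 1%N) mr.
    have -> : - (- 1 / 8) - 1 / 2 = - 3 / 8 :> rat by field.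
    by move=> mr'; exact: eqmodZp_binsum p_prime mr mr' z1.
  (* For [p = 8 * m + 3] the two parameters exchange roles. *)
  have mr : eqmodZp p (- 3 / 8) m%:R.
    by apply: (@eqmodZp_eighth _ 3 _ 1) => //; rewrite mul1n.
  have := eqmodZp_opp_sub _ _ _ _ (V2 1%N) mr.
  have -> : - (- 3 / 8) - 1 / 2 = - 1 / 8 :> rat by field.
  by move=> mr'; rewrite [S1]binsumC; exact: eqmodZp_binsum p_prime mr mr' z1.
(* Here [c] is the residue of [-5/8]; that of [-1/8] exceeds it by [(p + 1) / 2], the residue of
   [1/2]. Pfaff's identity at [1 / t] contributes [t ^- c], so [t ^+ p./2 * t] is left. *)
have S2_legendre c : (c + p./2.+1 < p)%N -> eqmodZp p (- 1 / 8) (c + p./2.+1)%:R ->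
    eqmodZp p (- 5 / 8) c%:R ->
  eqmodZp p S2 ((legendre_symbol p t)%:~R * (t * binsum p (- 5 / 8) (- 7 / 8) (1 - t))).
  move=> ap' ac cr; rewrite /S2 (residue_unique _ _ _ p_prime ap' ac).
  apply: (eqmodZp_trans _
      (t ^+ (c + p./2.+1) * binsum p c%:R (- 1 / 8) (1 - 1 / t))).
    apply: eqmodZpM; first by apply: eqmodZp_refl; apply: rpredX.
    rewrite -/(binsum _ _ _ _) binsumC.
    exact: eqmodZp_binsum p_prime cr (V8 1%N) z2.
  have tV0 : 1 / t != 0 by rewrite div1r invr_eq0.
  rewrite (binsum_pfaff _ _ _ _ tV0 (leq_ltn_trans (leq_addr _ _) ap')).
  have -> : - 1 - - 1 / 8 = - 7 / 8 :> rat by field.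
  rewrite !div1r invrK exprVn exprD exprSr.
  set B := binsum _ _ _ _.
  have -> : t ^+ c * (t ^+ p./2 * t) * (t ^- c * B) = t ^+ p./2 * (t * B).
    by field; rewrite expf_neq0.
  apply: eqmodZpM; first exact: eqmodZp_legendre_symbol.
  apply: eqmodZpM; first exact: eqmodZp_refl.
  exact: eqmodZp_binsum p_prime (eqmodZp_sym _ _ _ cr) (V8 7%N) z1.
move=> /mod8_57[m [mE mp hm]].
(* The odd Legendre polynomial brings a factor [s], which with the explicit [s] makes [t]. *)
exists ((legendre_symbol p t)%:~R * (t * binsum p m%:R (- m%:R - 3 / 2) (1 - t))).
  have [_ Pm] := legendreP_binsum _ m p s _ mp ws.
  by rewrite mE Pm !rmorphM /= rmorph_int -(sqrtCK (ratr t)) -/s; ring.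
case: hm => -[pm hp ha].
  have mr : eqmodZp p (- 5 / 8) m%:R.
    by apply: (@eqmodZp_eighth _ 5 _ 1) => //; rewrite mul1n.
  have ar := @eqmodZp_eighth _ 1 _ 5 podd ha.
  apply: eqmodZp_trans (S2_legendre m hp ar mr) _; apply: legendreZ.
  have := eqmodZp_opp_sub _ _ _ _ (V2 3%N) mr.
  have -> : - (- 5 / 8) - 3 / 2 = - 7 / 8 :> rat by field.
  by move=> mr'; exact: eqmodZp_binsum p_prime mr mr' z1.
(* For [p = 8 * m + 7] it is [-7/8] that reduces to [m], while [c = 3 * m + 2]; symmetry of the sum
   reconciles the two. *)
have mr : eqmodZp p (- 7 / 8) m%:R.
  by apply: (@eqmodZp_eighth _ 7 _ 1) => //; rewrite mul1n.
case: ha => ha hc.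
have ar := @eqmodZp_eighth _ 1 _ 7 podd ha.
have cr := @eqmodZp_eighth _ 5 _ 3 podd hc.
apply: eqmodZp_trans (S2_legendre _ hp ar cr) _; apply: legendreZ.
rewrite binsumC; have := eqmodZp_opp_sub _ _ _ _ (V2 3%N) mr.
have -> : - (- 7 / 8) - 3 / 2 = - 5 / 8 :> rat by field.
by move=> mr'; exact: eqmodZp_binsum p_prime mr mr' z1.
Qed.
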